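(* Let $k\geq 5$ be an integer and let $G$ be a connected graph of order \[n\geq \max\left\{k^2+k,\ \frac{\lfloor\frac{k}{2}\rfloor\cdot k(k-2)+k^2-5k+3}{k-4}\right\}.\] If $\deg(x)+\deg(y)\geq \frac{2n-2k+1}{k}$ for any two non-adjacent vertices $x$ and $y$ of $G$, then $G$ has at most $k-2$ cut edges.
   Context: All graphs are finite, simple and undirected; $\deg(x)$ is the degree of $x$ in $G$; a cut edge is an edge whose removal disconnects the graph. *)

(* Defs.v *)
From mathcomp Require Import all_boot all_order all_algebra.
Set Implicit Arguments.
Unset Strict Implicit.
Unset Printing Implicit Defensive.

(* A finite simple undirected graph is given by its adjacency relation [e] on
   the finite vertex type [T]; an edge is a two-element set of vertices. *)

Definition simple_graph (T : finType) (e : rel T) : Prop :=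
  symmetric e /\ irreflexive e.

Definition deg (T : finType) (e : rel T) (x : T) : nat := #|[set y | e x y]|.

Definition edges (T : finType) (e : rel T) : {set {set T}} :=
  [set f : {set T} | [exists x, exists y, e x y && (f == [set x; y])]].

Definition connected (T : finType) (e : rel T) : bool :=
  [forall x, forall y, connect e x y].

Definition delete_edge (T : finType) (e : rel T) (f : {set T}) : rel T :=
  [rel x y | e x y && ([set x; y] != f)].

(* Meant for connected [e]: otherwise deleting any edge leaves a disconnected
   graph. *)
Definition cut_edges (T : finType) (e : rel T) : {set {set T}} :=
  [set f in edges e | ~~ connected (delete_edge e f)].

(* Main.v *)
(* Suppose there are k - 1 cut edges; let F be a set of k - 1 of them, so that
   G - F has k components.  Call a component saturated if all its vertices meet
   F.  A vertex of an unsaturated component H not meeting F has degree at most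
   |H| - 1, while a vertex of a saturated component H has degree at most the
   number of edges of F leaving H, hence at most k - 1.  Vertices of degree at
   most k - 1 are pairwise adjacent because n >= k^2 + k, and cut edges lie on no
   triangle, so at most two components are saturated.  Without saturated
   components, averaging |H| - 1 over the k components contradicts the degree
   condition; with one or two of them, a low-degree vertex there forces all other
   components to be too large.  If there are two, they share at most one edge of
   F, so one of them is left by at most k/2 edges of F: this is where the second
   lower bound on n comes from. *)
Require Import Defs.
From mathcomp Require Import all_boot all_order all_algebra zify lra.
Import Order.TTheory GRing.Theory Num.Theory.

(** * Numerical contradictions closing each case of the count *)

Section Arithmetic.

Context (k n : nat) (k5 : 5 <= k).

(** Here [m] is the size of a smallest component. Moving [k * m] to the right leaves
    [(k - 2) * (k * m) <= (k - 2) * n] there, so [(k - 1) * (2 * n + 1)] would be at most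
    [(2 * k - 2) * n]. *)
Lemma no_saturated_arith m : k * m <= n ->
  (k - 1) * (2 * n + 1) + k * ((k - (k - 1)) * m)
    <= k * n + (k - 1) * (k * m) -> False.
Proof.
move=> km; have -> : k - (k - 1) = 1 by lia.
have := leq_mul (leqnn (k - 2)) km.
(* Writing [k] as [j + 5] removes truncated subtraction, so that only polynomials with natural
   coefficients remain. *)
have [j Ek] : exists j, k = j + 5 by exists (k - 5); lia.
rewrite Ek; have [-> ->] : j + 5 - 2 = j + 3 /\ j + 5 - 1 = j + 4 by lia.
by lia.
Qed.

(* For [n = k ^ 2 + k] the averaged bound is off by one and only the integrality
   of the component sizes saves it. *)
Lemma large_component_arith m b : b <= k - 1 ->
  2 * (k ^ 2 + k) + 1 <= k * m + k * b.+1 -> k + 3 <= m.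
Proof.
move=> bk le; rewrite leqNgt; apply/negP => mk.
have : k * m <= k * (k + 2) by rewrite leq_mul2l; lia.
have : k * b.+1 <= k * k by rewrite leq_mul2l; lia.
by lia.
Qed.

Lemma large_components_arith :
  (k - 1) * (k * (k + 3)) + k * ((k - (k - 1)) * 1)
    <= k * (k ^ 2 + k) + (k - 1) * 0 -> False.
Proof.
have -> : k - (k - 1) = 1 by lia.
have [j Ek] : exists j, k = j + 5 by exists (k - 5); lia.
rewrite Ek; have -> : j + 5 - 1 = j + 4 by lia.
by nia.
Qed.

(** In the worst case [b = k - 1] the inequality reads [(k - 2) * n + 2 * k - 1 <= (k - 1) * k ^ 2],
    which fails from [n = k ^ 2 + k + 1] on. *)
Lemma one_saturated_arith b : k ^ 2 + k < n -> b <= k - 1 ->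
  (k - 1) * (2 * n + 1) + k * ((k - (k - 1)) * 1)
    <= k * n + (k - 1) * (k * b.+1) -> False.
Proof.
move=> nk bk; have -> : k - (k - 1) = 1 by lia.
have : (k - 1) * (k * b.+1) <= (k - 1) * (k * k).
  by rewrite !leq_mul2l; lia.
have := leq_mul (leqnn (k - 2)) nk.
have [j Ek] : exists j, k = j + 5 by exists (k - 5); lia.
rewrite Ek; have [-> ->] : j + 5 - 2 = j + 3 /\ j + 5 - 1 = j + 4 by lia.
by lia.
Qed.

(** For [b = k %/ 2], collecting terms gives [n * (k - 4) + 5 * k <= (k %/ 2) * (k * (k - 2)) + k ^
    2 + 2], which misses the second bound on [n] by exactly one. *)
Lemma two_saturated_arith b : b <= k %/ 2 ->
  (k %/ 2) * (k * (k - 2)) + k ^ 2 + 3 <= n * (k - 4) + 5 * k ->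
  (k - 2) * (2 * n + 1) + k * ((k - (k - 2)) * 1)
    <= k * n + (k - 2) * (k * b.+1) -> False.
Proof.
move=> bk; have -> : k - (k - 2) = 2 by lia.
have : (k - 2) * (k * b.+1) <= (k - 2) * (k * (k %/ 2).+1).
  by rewrite !leq_mul2l; lia.
move: (k %/ 2) => q.
have [j Ek] : exists j, k = j + 5 by exists (k - 5); lia.
rewrite Ek; have [-> ->] : j + 5 - 2 = j + 3 /\ j + 5 - 4 = j + 1 by lia.
by lia.
Qed.

Lemma low_degrees_arith a b : k ^ 2 + k <= n -> a <= k - 1 -> b <= k - 1 ->
  2 * n + 1 <= k * (b + a) + 2 * k -> false.
Proof.
move=> nk ak bk.
have : k * (b + a) <= k * (2 * (k - 1)) by rewrite leq_mul2l; lia.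
have [j Ek] : exists j, k = j + 5 by exists (k - 5); lia.
rewrite Ek in nk *; have -> : j + 5 - 1 = j + 4 by lia.
by lia.
Qed.

End Arithmetic.

(** * Deletion of cut edges and the resulting components *)

Section CutEdges.

Context (T : finType) (e : rel T).
Hypotheses (e_sym : symmetric e) (e_irr : irreflexive e).
Hypothesis e_conn : connected e.

Implicit Types (F : {set {set T}}) (H S : {set T}) (x y : T).

Definition delete_edges F : rel T :=
  [rel x y | e x y && ([set x; y] \notin F)].

Definition component F x : {set T} :=
  [set y | connect (delete_edges F) x y].

Definition deleted_nbrs F x : {set T} :=
  [set y | e x y && ([set x; y] \in F)].

Definition deleted_arcs F H : {set T * T} :=
  [set p | (p.1 \in H) && (p.2 \in deleted_nbrs F p.1)].

Definition boundary F H : {set {set T}} :=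
  [set [set p.1; p.2] | p in deleted_arcs F H].

Definition saturated F H : bool :=
  [forall (x | x \in H), deleted_nbrs F x != set0].

Lemma delete_edge_sym f : symmetric (delete_edge e f).
Proof. by move=> x y; rewrite /delete_edge /= e_sym setUC. Qed.

Lemma delete_edges_sym F : symmetric (delete_edges F).
Proof. by move=> x y; rewrite /delete_edges /= e_sym setUC. Qed.

Lemma connect_delete_edgesC F : connect_sym (delete_edges F).
Proof. exact/sym_connect_sym/delete_edges_sym. Qed.

(** If the ends stayed connected, every use of the edge in a walk could be replaced by a detour, so
    the deletion would keep the whole graph connected. *)
Lemma cut_edge_disconnects x y :
  [set x; y] \in cut_edges e -> ~~ connect (delete_edge e [set x; y]) x y.
Proof.
rewrite inE => /andP[_]; apply: contra => cxy.
have csym := sym_connect_sym (delete_edge_sym [set x; y]).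
apply/forallP => u; apply/forallP => v.
have /forallP/(_ u)/forallP/(_ v) := e_conn.
apply: connect_sub => a b eab.
have [abxy|abxy] := eqVneq [set a; b] [set x; y]; last first.
  by apply: connect1; rewrite /delete_edge /= eab.
have ab : a != b by apply: contraTneq eab => ->; rewrite e_irr.
have : a \in [set x; y] by rewrite -abxy !inE eqxx.
have : b \in [set x; y] by rewrite -abxy !inE eqxx orbT.
rewrite !inE => /orP[]/eqP-> /orP[]/eqP-> //; by rewrite csym.
Qed.

Lemma connect_delete_edges_sub F f x y : f \in F ->
  connect (delete_edges F) x y -> connect (delete_edge e f) x y.
Proof.
move=> fF; apply: connect_sub => a b /andP[eab abF]; apply: connect1.
by rewrite /delete_edge /= eab; apply: contraNneq abF => ->.
Qed.

Lemma deleted_edge_disconnects F x y : F \subset cut_edges e ->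
  [set x; y] \in F -> ~~ connect (delete_edges F) x y.
Proof.
move=> /subsetP Fcut xyF; apply: contra (cut_edge_disconnects _ _ (Fcut _ xyF)).
exact: connect_delete_edges_sub.
Qed.

Lemma connect_delete_edgesS (F F' : {set {set T}}) x y : F' \subset F ->
  connect (delete_edges F) x y -> connect (delete_edges F') x y.
Proof.
move=> /subsetP FF; apply: connect_sub => a b /andP[eab abF].
by apply: connect1; rewrite /delete_edges /= eab; apply: contra abF => /FF.
Qed.

(** Induction on [#|F|]: put back an edge [xy] of [F]. Its ends then share a component [C], which
    holds at most one vertex of the set [S'] obtained so far; trading that vertex for [x] and [y]
    gains at least one. *)
Lemma separated_set_exists F :
  0 < #|T| -> F \subset cut_edges e ->
  exists2 S : {set T}, #|F| < #|S| &
    {in S &, forall x y, connect (delete_edges F) x y -> x = y}.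
Proof.
move=> T_gt0; move: {2}#|F| (erefl #|F|) => m.
elim: m F => [|m IH] F cardF Fcut.
  have /card_gt0P[x _] := T_gt0; exists [set x]; first by rewrite cards1 cardF.
  by move=> a b; rewrite !inE => /eqP-> /eqP->.
have /card_gt0P[f fF] : 0 < #|F| by rewrite cardF.
have cardF' : #|F :\ f| = m by move: cardF; rewrite (cardsD1 f) fF => -[].
have sF' : F :\ f \subset F by apply: subsetDl.
have [S' cardS' sepS'] := IH _ cardF' (subset_trans sF' Fcut).
have : f \in edges e by have := subsetP Fcut _ fF; rewrite inE => /andP[].
rewrite inE => /existsP[x /existsP[y /andP[exy /eqP fxy]]].
have ncxy : ~~ connect (delete_edges F) x y.
  by apply: deleted_edge_disconnects; rewrite // -fxy.
pose C := component (F :\ f) x.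
have cxy : connect (delete_edges (F :\ f)) x y.
  by apply: connect1; rewrite /delete_edges /= exy fxy !inE eqxx.
have xy : x != y by apply: contraNneq ncxy => ->.
have S'C : #|S' :&: C| <= 1.
  apply/card_le1_eqP => a b; rewrite !inE => /andP[aS' ca] /andP[bS' cb].
  by apply: sepS' => //; rewrite (connect_trans _ ca) // connect_delete_edgesC.
exists (x |: (y |: (S' :\: C))).
  rewrite !cardsU1 !inE connect0 cxy (negPf xy) /= cardF.
  by move: cardS' (cardsID C S'); rewrite cardF'; lia.
have outC a z : connect (delete_edges (F :\ f)) x z -> a \in S' :\: C ->
    connect (delete_edges F) z a -> False.
  move=> xz; rewrite !inE => /andP[/negP nca _] za; apply: nca.
  exact: connect_trans xz (connect_delete_edgesS _ _ _ _ sF' za).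
have xx := connect0 (delete_edges (F :\ f)) x.
move=> a b; rewrite in_setU1 [a \in _]in_setU1 => aS.
rewrite in_setU1 [b \in _]in_setU1 => bS cab; move: (cab) aS bS.
rewrite connect_delete_edgesC => cba.
case/or3P=> [/eqP Ea|/eqP Ea|aS]; case/or3P=> [/eqP Eb|/eqP Eb|bS];
  rewrite ?Ea ?Eb //; rewrite ?Ea ?Eb in cab cba.
- by case/negP: ncxy.
- by case: (outC _ _ xx bS cab).
- by case/negP: ncxy.
- by case: (outC _ _ cxy bS cab).
- by case: (outC _ _ xx aS cba).
- by case: (outC _ _ cxy aS cba).
- move: aS bS; rewrite !inE => /andP[_ aS'] /andP[_ bS'].
  by apply: sepS' => //; apply: connect_delete_edgesS cab.
Qed.

(** Double counting: a vertex lies in the component of at most one element of [S]. *)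
Lemma sum_card_component F S :
  {in S &, forall x y, connect (delete_edges F) x y -> x = y} ->
  \sum_(r in S) #|component F r| <= #|T|.
Proof.
move=> sep; under eq_bigr do rewrite -sum1_card big_mkcond.
rewrite exchange_big /= -sum1_card leq_sum // => y _.
rewrite -big_mkcondr sum1_card; apply/card_le1_eqP => a b.
move=> /andP[aS +] /andP[bS +]; rewrite !inE => ay yb.
by apply: sep => //; rewrite (connect_trans yb) // connect_delete_edgesC.
Qed.

(** * Degrees and the deleted edges leaving a component *)

Lemma deg_component F r x : x \in component F r ->
  deg e x < #|component F r| + #|deleted_nbrs F x|.
Proof.
rewrite inE => rx.
(* Counting [x], which lies in its component but is not its own neighbour, makes the bound
   strict. *)
have <- : #|x |: [set y | e x y]| = (deg e x).+1.
  by rewrite cardsU1 inE e_irr.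
apply: leq_trans (leq_card_setU _ _); apply/subset_leq_card/subsetP => y.
rewrite !inE => /orP[/eqP->|exy]; first by rewrite rx.
have [xyF|xyF] := boolP ([set x; y] \in F); first by rewrite exy orbT.
by rewrite (connect_trans rx) // connect1 // /delete_edges /= exy.
Qed.

(** A deleted cut edge joins two different components, so it has at most one end in this one and is
    counted once. *)
Lemma sum_deleted_nbrs F r : F \subset cut_edges e ->
  \sum_(x in component F r) #|deleted_nbrs F x| =
  #|boundary F (component F r)|.
Proof.
move=> Fcut; rewrite card_in_imset => [|[a b] [c d]].
  under eq_bigr do rewrite -sum1_card.
  rewrite pair_big_dep -sum1_card; apply: eq_bigl => -[a b] /=.
  by rewrite [in RHS]inE.
rewrite !inE /= => /and3P[ra _ abF] /and3P[rc _ cdF] abcd.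
have rb : ~~ connect (delete_edges F) r b.
  apply: contra (deleted_edge_disconnects _ _ _ Fcut abF) => rb.
  by rewrite (connect_trans _ rb) // connect_delete_edgesC.
have rd : ~~ connect (delete_edges F) r d.
  apply: contra (deleted_edge_disconnects _ _ _ Fcut cdF) => rd.
  by rewrite (connect_trans _ rd) // connect_delete_edgesC.
have : a \in [set c; d] by rewrite -abcd !inE eqxx.
have : b \in [set c; d] by rewrite -abcd !inE eqxx orbT.
rewrite !inE => /orP[]/eqP Eb /orP[]/eqP Ea; rewrite ?Ea ?Eb //.
- by case/negP: rb; rewrite Eb.
- by case/negP: rb; rewrite Eb.
- by case/negP: rd; rewrite -Ea.
Qed.

Lemma boundary_sub F H : boundary F H \subset F.
Proof.
apply/subsetP => f /imsetP[[a b]]; rewrite !inE /= => /and3P[_ _ abF] ->.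
exact: abF.
Qed.

(* Every other vertex of [H] already contributes one edge to the boundary. *)
Lemma deg_saturated F r x : F \subset cut_edges e ->
  saturated F (component F r) -> x \in component F r ->
  deg e x <= #|boundary F (component F r)|.
Proof.
move=> Fcut /forall_inP sat rx; rewrite -sum_deleted_nbrs //.
have := deg_component _ _ _ rx; rewrite (bigD1 x) //= (cardsD1 x) rx.
suff : #|component F r :\ x| <=
    \sum_(i in component F r | i != x) #|deleted_nbrs F i| by lia.
rewrite -sum1_card.
rewrite [leqLHS](eq_bigl (fun i => (i \in component F r) && (i != x))).
  by apply: leq_sum => i /andP[ri _]; rewrite card_gt0 sat.
by move=> i; rewrite in_setD1 andbC.
Qed.

(* A second deleted edge between the two components would bypass the first. *)
Lemma card_boundaryI F r r' : F \subset cut_edges e ->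
  ~~ connect (delete_edges F) r r' ->
  #|boundary F (component F r) :&: boundary F (component F r')| <= 1.
Proof.
move=> Fcut nrr'.
have csym := connect_delete_edgesC F.
have ends f :
    f \in boundary F (component F r) :&: boundary F (component F r') ->
    exists a b, [/\ e a b, [set a; b] \in F, f = [set a; b],
      connect (delete_edges F) r a & connect (delete_edges F) r' b].
  rewrite inE => /andP[/imsetP[[a b] + fab] /imsetP[[c d] + fcd]].
  rewrite !inE /= => /and3P[ra eab abF] /and3P[r'c ecd cdF].
  exists a, b; split => //.
  have : c \in [set a; b] by rewrite -[[set a; b]]fab fcd !inE eqxx.
  rewrite !inE => /orP[]/eqP Ec; last by rewrite -Ec.
  by case/negP: nrr'; rewrite (connect_trans ra) // csym -Ec.
apply/card_le1_eqP => f f' /ends[a [b [eab abF -> ra r'b]]].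
move=> /ends[c [d [ecd cdF -> rc r'd]]]; apply/eqP.
apply: contraT => neq.
have /negP[] := cut_edge_disconnects _ _ (subsetP Fcut _ abF).
apply: (@connect_trans _ _ c).
  apply: (connect_delete_edges_sub _ _ _ _ abF).
  by rewrite (connect_trans _ rc) // csym.
apply: (@connect_trans _ _ d).
  by apply: connect1; rewrite /delete_edge /= ecd.
apply: (connect_delete_edges_sub _ _ _ _ abF).
by rewrite (connect_trans _ r'b) // csym.
Qed.

Lemma card_boundaryD F r r' : F \subset cut_edges e ->
  ~~ connect (delete_edges F) r r' ->
  #|boundary F (component F r)| + #|boundary F (component F r')| <= #|F|.+1.
Proof.
move=> Fcut /(card_boundaryI _ _ _ Fcut) le1; rewrite -cardsUI -addn1.
by rewrite leq_add // subset_leq_card // subUset !boundary_sub.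
Qed.

(** The path through [z] survives the deletion of the edge [xy]. *)
Lemma no_cut_triangle x y z : e x z -> e z y -> x != y ->
  [set x; y] \notin cut_edges e.
Proof.
move=> exz ezy xy; apply/negP => /cut_edge_disconnects/negP; apply.
have zx : z != x by apply: contraTneq exz => ->; rewrite e_irr.
have zy : z != y by apply: contraTneq ezy => ->; rewrite e_irr.
have ne a : [set a; z] != [set x; y].
  apply/eqP/setP => /(_ z).
  by rewrite !inE eqxx orbT (negPf zx) (negPf zy).
apply: (@connect_trans _ _ z); apply: connect1; rewrite /delete_edge /=.
  by rewrite exz ne.
by rewrite ezy setUC ne.
Qed.

(** * Representatives of components and a weighted count *)

(** A vertex meeting no edge of [F] if there is one; in a saturated component any vertex serves, and
    [r] is the default. *)
Definition representative F r : T :=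
  odflt r [pick x in component F r | deleted_nbrs F x == set0].

Lemma representative_in F r : representative F r \in component F r.
Proof.
by rewrite /representative; case: pickP => [x /andP[]|_] //=; rewrite inE.
Qed.

Lemma representative_unsaturated F r : ~~ saturated F (component F r) ->
  deleted_nbrs F (representative F r) = set0.
Proof.
rewrite /representative; case: pickP => [x /andP[_ /eqP]//|none] /negP[].
apply/forall_inP => x rx; apply/negbT.
by have := none x; rewrite rx.
Qed.

(** [A] collects the components made large by the degree condition, the others having only the crude
    bound [m]. The factor [k] clears the denominator, and [b] stands on the right to avoid
    subtraction. *)
Lemma weighted_sum_card_component F S (A : {set T}) (k b c m : nat) :
  {in S &, forall x y, connect (delete_edges F) x y -> x = y} ->
  A \subset S ->
  {in A, forall r, c <= k * #|component F r| + b} ->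
  {in S :\: A, forall r, m <= #|component F r|} ->
  #|A| * c + k * ((#|S| - #|A|) * m) <= k * #|T| + #|A| * b.
Proof.
move=> sep AS hA hSA.
have leT : \sum_(r in A) #|component F r| +
    \sum_(r in S :\: A) #|component F r| <= #|T|.
  by rewrite -[in X in X + _](setIidPr AS) -big_setID sum_card_component.
have leA : #|A| * c <= k * \sum_(r in A) #|component F r| + #|A| * b.
  by rewrite -!sum_nat_const big_distrr -big_split leq_sum.
have leSA : (#|S| - #|A|) * m <= \sum_(r in S :\: A) #|component F r|.
  by rewrite -(cardsDS AS) -sum_nat_const leq_sum.
apply: leq_trans (leq_add leA (leq_mul (leqnn k) leSA)) _.
by rewrite addnAC -mulnDr leq_add2r leq_mul2l leT orbT.
Qed.

(** * The counting argument over the natural numbers, with denominators cleared *)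

Lemma card_cut_edges_le (k : nat) : 5 <= k ->
  k ^ 2 + k <= #|T| ->
  (k %/ 2) * (k * (k - 2)) + k ^ 2 + 3 <= #|T| * (k - 4) + 5 * k ->
  (forall x y, x != y -> ~~ e x y ->
     2 * #|T| + 1 <= k * (deg e x + deg e y) + 2 * k) ->
  #|cut_edges e| <= k - 2.
Proof.
move=> k5 n_ge n_ge' ore; rewrite leqNgt; apply/negP => many.
have [F Fcut cardF] : exists2 F : {set {set T}},
    F \subset cut_edges e & #|F| = k - 1.
  have /card_geqP[s [us ss sub]] : k - 1 <= #|cut_edges e| by lia.
  exists [set f in s]; last by rewrite cardsE (card_uniqP us).
  by apply/subsetP => f; rewrite inE => /sub.
have T_gt0 : 0 < #|T| by lia.
have [S cardS sep] : exists2 S : {set T}, #|S| = k &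
    {in S &, forall x y, connect (delete_edges F) x y -> x = y}.
  have [S' cardS' sep'] := separated_set_exists _ T_gt0 Fcut.
  have /card_geqP[s [us ss sub]] : k <= #|S'| by rewrite cardF in cardS'; lia.
  exists [set x in s]; first by rewrite cardsE (card_uniqP us).
  by move=> x y; rewrite !inE => /sub xS /sub yS; apply: sep'.
have csym := connect_delete_edgesC F.
pose g := representative F; pose h r := #|component F r|.
pose bd r := #|boundary F (component F r)|.
pose Sat := [set r in S | saturated F (component F r)].
have SatS : Sat \subset S by apply/subsetP => r; rewrite inE => /andP[].
have nconn : {in S &, forall r r', r != r' ->
    ~~ connect (delete_edges F) r r'}.
  by move=> r r' rS r'S; apply: contraNN => /sep-> //.
have rg r : connect (delete_edges F) r (g r).
  by have := representative_in F r; rewrite inE.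
have gnconn : {in S &, forall r r', r != r' ->
    ~~ connect (delete_edges F) (g r) (g r')}.
  move=> r r' rS r'S /(nconn _ _ rS r'S); apply: contra => gg.
  by rewrite (connect_trans (rg r)) // (connect_trans gg) // csym.
have gneq : {in S &, forall r r', r != r' -> g r != g r'}.
  move=> r r' rS r'S /(gnconn _ _ rS r'S); apply: contraNneq => ->.
  exact: connect0.
have gF : {in S &, forall r r', r != r' -> e (g r) (g r') ->
    [set g r; g r'] \in F}.
  move=> r r' rS r'S rr' egg; have := gnconn _ _ rS r'S rr'.
  apply: contraNT => ggF; apply: connect1.
  by rewrite /delete_edges /= egg.
have h_gt0 r : 0 < h r by apply/card_gt0P; exists r; rewrite inE.
have bd_le r : bd r <= k - 1.
  by rewrite -cardF subset_leq_card // boundary_sub.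
have gsat : {in Sat, forall r, deg e (g r) <= bd r}.
  move=> r; rewrite inE => /andP[_ rsat].
  exact: deg_saturated (representative_in _ _).
(* Adjacent representatives are joined by an edge of [F], but [g r'] meets none. Its degree is less
   than [h r'], which absorbs one of the two terms [k]. *)
have unsat : {in S & S :\: Sat, forall r r', r != r' ->
    2 * #|T| + 1 <= k * (deg e (g r) + h r') + k}.
  move=> r r' rS; rewrite !inE => /andP[nsat r'S] rr'; rewrite r'S /= in nsat.
  have no_nbr := representative_unsaturated _ _ nsat.
  have ngg : ~~ e (g r) (g r').
    apply/negP => egg; have ggF := gF _ _ rS r'S rr' egg.
    have : g r \in deleted_nbrs F (g r').
      by rewrite inE e_sym egg setUC ggF.
    by rewrite /g no_nbr inE.
  have := ore _ _ (gneq _ _ rS r'S rr') ngg.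
  have := deg_component _ _ _ (representative_in F r').
  rewrite no_nbr cards0 addn0 -/(g r') -/(h r') => lt_h le_d.
  apply: leq_trans le_d _.
  rewrite mul2n -addnn addnA -mulnSr leq_add2r leq_mul2l -addnS leq_add2l.
  by rewrite lt_h orbT.
have sat_adj : {in Sat &, forall r r', r != r' -> e (g r) (g r')}.
  move=> r r' rSat r'Sat rr'; apply: contraT => ngg.
  have [rS r'S] := (subsetP SatS _ rSat, subsetP SatS _ r'Sat).
  have := ore _ _ (gneq _ _ rS r'S rr') ngg.
  have := leq_trans (gsat _ rSat) (bd_le r).
  have := leq_trans (gsat _ r'Sat) (bd_le r').
  exact: low_degrees_arith.
have Sat_le2 : #|Sat| <= 2.
  (* Three saturated components would give a triangle of representatives with sides in [F], that is,
     cut edges. *)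
  rewrite leqNgt; apply/negP => /card_gt2P[a [b [c [[aS bS cS] [ab bc ca]]]]].
  have [aS' bS'] := (subsetP SatS _ aS, subsetP SatS _ bS).
  have := no_cut_triangle _ _ _ _ _ (gneq _ _ aS' bS' ab).
  move=> /(_ (g c)); rewrite [e (g a) _]e_sym !sat_adj // 1?eq_sym //.
  by move=> /(_ isT isT)/negP[]; apply/(subsetP Fcut)/gF; rewrite ?sat_adj.
have cardU : #|S :\: Sat| = k - #|Sat| by rewrite cardsDS // cardS.
have low r : r \in Sat -> {in S :\: Sat, forall r',
    2 * #|T| + 1 <= k * h r' + (k * (bd r).+1)}.
  move=> rSat r' r'U.
  have rr' : r != r' by apply: contraTneq r'U => <-; rewrite inE rSat.
  have := unsat _ _ (subsetP SatS _ rSat) r'U rr'.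
  move=> le_d; apply: leq_trans le_d _.
  rewrite mulnSr addnA leq_add2r -mulnDr addnC leq_mul2l leq_add2l.
  by rewrite gsat ?orbT.
have [Sat0|[r rSat]] := set_0Vmem Sat.
- have [r0 r0S] : exists r0, r0 \in S by apply/card_gt0P; rewrite cardS; lia.
  (* A smallest component has at most [#|T| / k] vertices; the degree condition against its
     representative makes all the others large. *)
  case: (@arg_minnP _ r0 (mem S) h r0S) => r rS min_r.
  have {}rS : r \in S by [].
  have S1 : S :\ r \subset S by apply: subsetDl.
  have cS1 : #|S :\ r| = k - 1 by rewrite cardsDS ?sub1set // cards1 cardS.
  have := @weighted_sum_card_component F S set0 1 0 0 (h r) sep (sub0set _).
  rewrite cards0 setD0 cardS => le0.
  have := @weighted_sum_card_component F S (S :\ r) k (k * h r) (2 * #|T| + 1)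
    (h r) sep S1.
  rewrite cS1 cardS => le1.
  have {}le0 : k * h r <= #|T|.
    by have := le0; rewrite subn0 !mul1n !mul0n add0n addn0; apply.
  have {}le1 : (k - 1) * (2 * #|T| + 1) + k * ((k - (k - 1)) * h r)
      <= k * #|T| + (k - 1) * (k * h r).
    apply: le1 => [r' r'S1|r' /setDP[r'S _]]; last exact: min_r.
    have [r'r r'S] := setD1P r'S1.
    have r'U : r' \in S :\: Sat by rewrite Sat0 setD0.
    have rU : r \in S :\: Sat by rewrite Sat0 setD0.
    have := unsat _ _ rS r'U; rewrite eq_sym => /(_ r'r).
    move: rU; rewrite !inE => /andP[]; rewrite rS /= => nsat _.
    have := deg_component _ _ _ (representative_in F r).
    rewrite representative_unsaturated // cards0 addn0 -/(g r) -/(h r) -/(h r').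
    move=> lt_h le_d; apply: leq_trans le_d _.
    by rewrite -mulnSr -mulnDr leq_mul2l -addSn addnC leq_add2l lt_h orbT.
  exact: no_saturated_arith le0 le1.
have [Sat1|Sat1] : #|Sat| = 1 \/ #|Sat| = 2.
  have : 0 < #|Sat| by apply/card_gt0P; exists r.
  by lia.
- rewrite Sat1 in cardU; have lowr := low _ rSat; have bdr := bd_le r.
  (* At equality each unsaturated component has at least [k + 2 + 1 / k] vertices, hence [k + 3],
     and this rounding is what gives the contradiction. *)
  have [En|n_neq] := eqVneq #|T| (k ^ 2 + k).
    have := @weighted_sum_card_component F S (S :\: Sat) k 0 (k * (k + 3)) 1
      sep (subsetDl _ _).
    rewrite cardU cardS => sum_le.
    have : (k - 1) * (k * (k + 3)) + k * ((k - (k - 1)) * 1)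
        <= k * #|T| + (k - 1) * 0.
      apply: sum_le => [r' /lowr|r' _]; last exact: h_gt0.
      rewrite addn0 leq_mul2l -/(h r') En => hr'; apply/orP; right.
      exact: large_component_arith bdr hr'.
    by rewrite En; apply: large_components_arith.
  have := @weighted_sum_card_component F S (S :\: Sat) k (k * (bd r).+1)
    (2 * #|T| + 1) 1 sep (subsetDl _ _) lowr (fun r _ => h_gt0 r).
  rewrite cardU cardS.
  by apply: one_saturated_arith => //; rewrite ltn_neqAle eq_sym n_neq.
(* The two boundaries have at most [#|F| + 1 = k] edges in total, so the smaller has at most
   [k %/ 2]. *)
- have [r' r'Sat bdr'] : exists2 r', r' \in Sat & bd r' <= k %/ 2.
    have /card_gt0P[r' ] : 0 < #|Sat :\ r|.
      by rewrite cardsDS ?sub1set // cards1 Sat1.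
    rewrite 2!inE => /andP[r'r r'Sat].
    have := card_boundaryD _ _ _ Fcut
      (nconn _ _ (subsetP SatS _ rSat) (subsetP SatS _ r'Sat) _).
    rewrite eq_sym => /(_ r'r); rewrite cardF -/(bd r) -/(bd r') => le_k.
    have [le_r|gt_r] := leqP (bd r) (k %/ 2); first by exists r.
    by exists r' => //; lia.
  rewrite Sat1 in cardU.
  have := @weighted_sum_card_component F S (S :\: Sat) k (k * (bd r').+1)
    (2 * #|T| + 1) 1 sep (subsetDl _ _) (low _ r'Sat) (fun r _ => h_gt0 r).
  rewrite cardU cardS.
  exact: two_saturated_arith bdr' n_ge'.
Qed.

End CutEdges.

(** * Transfer from rational to natural inequalities *)

Local Open Scope ring_scope.

Theorem theorem3p4 (k : nat) (T : finType) (e : rel T)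
  (hk : (5 <= k)%N)
  (hG : simple_graph e)
  (hconn : connected e)
  (hn : Num.max (k%:R ^+ 2 + k%:R)
          (((k %/ 2)%N%:R * (k%:R * (k%:R - 2)) + k%:R ^+ 2 - 5 * k%:R + 3)
             / (k%:R - 4))
        <= #|T|%:R :> rat)
  (hdeg : forall x y : T, x != y -> ~~ e x y ->
    (2 * #|T|%:R - 2 * k%:R + 1) / k%:R <= (deg e x + deg e y)%N%:R :> rat) :
  (#|cut_edges e| <= k - 2)%N.
Proof.
case: hG => e_sym e_irr; move: hn; rewrite ge_max => /andP[n_ge n_ge'].
have k5 : 5 <= k%:R :> rat by rewrite (ler_nat rat 5 k).
apply: card_cut_edges_le => // [||x y xy nexy].
- by rewrite -(ler_nat rat) natrD natrX.
(* The denominator is positive since [k] is at least 5; the term [5 * k] changes sides to stay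
   within the naturals. *)
- have k4 : 0 < k%:R - 4 :> rat by lra.
  move: n_ge'; rewrite ler_pdivrMr // => n_ge'.
  rewrite -(ler_nat rat) !natrD !natrM !natrB ?natrX; try lia.
  by lra.
- have k0 : 0 < k%:R :> rat by lra.
  have := hdeg x y xy nexy; rewrite ler_pdivrMr // => deg_ge.
  rewrite -(ler_nat rat) !natrD !natrM natrD; move: deg_ge; rewrite natrD.
  by lra.
Qed.
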